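(* Let $a,b,c$ be positive integers with $(a,b,c)\neq(1,1,1)$ and $\gcd(a,b,c)=1$. Assume that two of the three fractions $\frac ba,\frac cb,\frac ca$ lie in $\{1,\frac53,7,15\}$. Then for every positive integer $n$, $$2t(a,b,c;n)=r\big(ax^2+by^2+cz^2,\,4(8n+a+b+c)\big)-r\big(ax^2+by^2+cz^2,\,8n+a+b+c\big).$$
   Context: For positive integers $a,b,c$ and an integer $n$, $t(a,b,c;n)$ denotes the number of $(x,y,z)\in\mathbb Z^3$ with $a\frac{x(x-1)}2+b\frac{y(y-1)}2+c\frac{z(z-1)}2=n$. For a positive definite integral quadratic form $h$ in $k$ variables and an integer $m$, $r(h,m)$ denotes the number of $v\in\mathbb Z^k$ with $h(v)=m$. *)

(* Defs.v *)
From mathcomp Require Import all_boot all_order all_algebra.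
From mathcomp Require Import finmap.
From mathcomp Require Import boolp classical_sets functions cardinality.
From mathcomp Require Import zify.
Set Implicit Arguments.
Unset Strict Implicit.
Unset Printing Implicit Defensive.
Import Order.TTheory GRing.Theory Num.Theory.
Local Open Scope classical_set_scope.
Local Open Scope ring_scope.

(* [fset_set A] is [fset0] when [A] is infinite, so [card_of A] is the number
   of elements of [A] only for finite [A]; [finite_tri_sols] and
   [finite_diag3_sols] below show that the counts used are genuine. *)
Definition card_of (T : choiceType) (A : set T) : nat := #|` fset_set A|%fset.

(* The Euclidean division by 2 is exact, since x (x - 1) is even. *)
Definition tri (x : int) : int := (x * (x - 1) %/ 2)%Z.

Definition tri_sols (a b c n : int) : set (int * int * int) :=
  [set v | a * tri v.1.1 + b * tri v.1.2 + c * tri v.2 = n].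

Definition t (a b c n : int) : nat := card_of (tri_sols a b c n).

(* Meant for positive definite integral forms [h], for which the set of
   representations of [m] is finite. *)
Definition r (k : nat) (h : 'rV[int]_k -> int) (m : int) : nat :=
  card_of [set v | h v = m].

Definition diag3 (a b c : int) (v : 'rV[int]_3) : int :=
  a * v 0 0 ^+ 2 + b * v 0 1 ^+ 2 + c * v 0 2%:R ^+ 2.

Definition frac_set : seq rat := [:: 1; 5%:R / 3%:R; 7%:R; 15%:R].

Lemma finite_int_box (N : nat) :
  finite_set [set v : int * int * int |
    [/\ `|v.1.1| <= N%:Z, `|v.1.2| <= N%:Z & `|v.2| <= N%:Z]].
Proof.
pose I : set int := [set x | `|x| <= N%:Z].
have finI : finite_set I.
  apply: (@sub_finite_set _ _
    [set (k%:Z - N%:Z)%R | k in `I_(N + N).+1]); last exact/finite_image/finite_II.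
  by move=> x; rewrite /I /= => hx; exists (absz (x + N%:Z)) => /=; lia.
have finB := finite_setX (finite_setX finI finI) finI.
by apply: sub_finite_set finB => -[[x y] z] [/= hx hy hz].
Qed.

Lemma tri2 (x : int) : 2 * tri x = x * (x - 1).
Proof.
rewrite mulrC /tri divzK //.
have [q [->|->]] : exists q : int, x = q * 2 \/ x = q * 2 + 1.
  by exists (x %/ 2)%Z; lia.
- by rewrite mulrAC dvdz_mull.
- by rewrite addrK mulrA dvdz_mull.
Qed.

Lemma finite_tri_sols (a b c n : int) :
  0 < a -> 0 < b -> 0 < c -> finite_set (tri_sols a b c n).
Proof.
move=> ha hb hc; apply: sub_finite_set (finite_int_box (`|n|.+1)%N).
move=> -[[x y] z]; rewrite /tri_sols /= => e.
have B w : `|w| <= tri w + 1 /\ 0 <= tri w by have := tri2 w; split; nia.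
have [] := B x; have [] := B y; have [] := B z.
move: (tri x) (tri y) (tri z) e => p q s e hz hs hy hq hx hp.
have hap : p <= a * p by nia.
have hbq : q <= b * q by nia.
have hcs : s <= c * s by nia.
by split; lia.
Qed.

Lemma finite_diag3_sols (a b c m : int) :
  0 < a -> 0 < b -> 0 < c -> finite_set [set v | diag3 a b c v = m].
Proof.
move=> ha hb hc.
pose f (p : int * int * int) : 'rV[int]_3 :=
  \row_i nth 0 [:: p.1.1; p.1.2; p.2] i.
apply: sub_finite_set (finite_image f (finite_int_box `|m|%N)).
move=> v; rewrite /diag3 /= => e.
exists (v 0 0, v 0 1, v 0 2%:R); last first.
  apply/rowP => i; rewrite mxE; case: i => -[|[|[|//]]] h /=;
    by congr (v _ _); apply: val_inj.
move: (v 0 0) (v 0 1) (v 0 2%:R) e => x y z e /=.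
have B (d w : int) : 0 < d -> `|w| <= d * w ^+ 2.
  by move=> hd; have : `|w| <= w ^+ 2 by [nia]; nia.
have := B _ x ha; have := B _ y hb; have := B _ z hc.
by move=> hz hy hx; split; lia.
Qed.

(* Main.v *)
(** Put [N = 8 n + a + b + c]. Completing squares, [t a b c n] counts the solutions of
    [a x^2 + b y^2 + c z^2 = N] with [x, y, z] all odd, and the right-hand side
    counts the solutions of [a x^2 + b y^2 + c z^2 = 4 N] that are not all even.
    Every fraction in [{5/3, 7, 15}] is [-1] modulo [8], so up to rotation [a = c = -b]
    modulo [8], and a solution of the second kind has either [x, y] odd and [z] even or
    [y, z] odd and [x] even. Each of these two families is in bijection with the
    odd solutions for [N]: halve the even coordinate, and divide the odd pair by an
    element of norm [4] in [Q(sqrt -7)] or [Q(sqrt -15)], or by its conjugate,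
    whichever keeps both coordinates odd integers. *)

Require Import Defs.
From mathcomp Require Import all_boot all_order all_algebra.
From mathcomp Require Import finmap.
From mathcomp Require Import boolp classical_sets functions cardinality.
From mathcomp Require Import zify ring.
Set Implicit Arguments.
Unset Strict Implicit.
Unset Printing Implicit Defensive.
Import Order.TTheory GRing.Theory Num.Theory.
Local Open Scope classical_set_scope.
Local Open Scope ring_scope.

(** * Cardinalities of finite sets *)

Lemma card_of_image (T U : choiceType) (f : T -> U) (A : set T) (B : set U) :
  finite_set A -> {in A &, injective f} -> f @` A = B -> card_of B = card_of A.
Proof.
move=> finA injf <-; rewrite /card_of fset_set_image //.
apply: card_in_imfset => x y; rewrite !in_fset_set // => xA yA; exact: injf.
Qed.

Lemma card_of_disjointU (T : choiceType) (A B : set T) :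
  finite_set A -> finite_set B -> A `&` B = set0 ->
  card_of (A `|` B) = (card_of A + card_of B)%N.
Proof.
move=> finA finB AB0; rewrite /card_of fset_setU // cardfsU -fset_setI //.
by rewrite AB0 fset_set0 cardfs0 subn0.
Qed.

(** * Parity and divisibility by powers of 2 *)

Definition oddz (x : int) : bool := (x %% 2)%Z == 1.

Lemma oddzP (x : int) : reflect (exists k : int, x = 2 * k + 1) (oddz x).
Proof.
apply: (iffP idP) => [ox|[k ->]]; last by rewrite /oddz; lia.
by exists (x %/ 2)%Z; rewrite /oddz in ox; lia.
Qed.

Lemma oddzM (x y : int) : oddz (x * y) = oddz x && oddz y.
Proof.
have oddzE z : oddz z = odd `|z|%N by rewrite /oddz; lia.
by rewrite !oddzE abszM oddM.
Qed.

Lemma oddzD (x y : int) : oddz (x + y) = oddz x (+) oddz y.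
Proof. by rewrite /oddz; lia. Qed.

Lemma oddzN (x : int) : oddz (- x) = oddz x.
Proof. by rewrite /oddz; lia. Qed.

Lemma half_evenz (x : int) : ~~ oddz x -> 2 * (x %/ 2)%Z = x.
Proof. by rewrite /oddz; lia. Qed.

(** Proves an equation modulo a hypothesis [u = v]: [k] is the cofactor of that hypothesis, and a
    polynomial identity remains. *)
Lemma lincomb (k u v l r : int) : u = v -> l + k * v = r + k * u -> l = r.
Proof. by move=> -> /addIr. Qed.
Arguments lincomb k {u v l r}.

Lemma mul2zI : injective (fun x : int => 2 * x).
Proof. by move=> x y /=; lia. Qed.

Lemma sqr_evenz (x : int) : ~~ oddz x ->
  exists2 k : int, x = 2 * k & x ^+ 2 = 4 * k ^+ 2.
Proof.
move=> ex; exists (x %/ 2)%Z; first by rewrite /oddz in ex; lia.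
have {1}-> : x = 2 * (x %/ 2)%Z by rewrite /oddz in ex; lia.
ring.
Qed.

(** An odd [m] forces [d] to absorb every factor 2, one per induction step. The equation [m * e = k]
    is kept so that the parity of [e] can be read off [k]. *)
Lemma oddz_dvd_exp2 (n : nat) (m d k : int) : oddz m -> m * d = 2 ^+ n * k ->
  exists2 e : int, d = 2 ^+ n * e & m * e = k.
Proof.
move=> om; elim: n d => [|n IHn] d e.
  by exists d; rewrite ?mul1r // e mul1r.
have /sqr_evenz[f ef _] : ~~ oddz d.
  have : ~~ oddz (m * d) by rewrite e exprS -mulrA oddzM.
  by rewrite oddzM om.
have [|g eg mg] := IHn f.
  by apply: (@mulfI _ 2) => //; rewrite mulrCA -ef e exprS mulrA.
by exists g => //; rewrite ef eg exprS mulrA.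
Qed.

Lemma sqr_oddz (x : int) : oddz x -> exists k : int, x ^+ 2 = 8 * k + 1.
Proof.
(* [tri (k + 1)] is the triangular number [k (k + 1) / 2]. *)
move=> /oddzP[k ->]; exists (tri (k + 1)).
by have := tri2 (k + 1); lia.
Qed.

(** The product of [u - w] and [u + w] is exactly divisible by 16. As [u] and [w] are odd, one
    factor is twice an odd number, so the other is 8 times an odd number; [s] selects it. *)
Lemma oddz_sqr_sub16 (u w k : int) : oddz u -> oddz w ->
  u ^+ 2 - w ^+ 2 = 32 * k + 16 ->
  exists2 s : int, s ^+ 2 = 1 & exists2 y : int, s * u - w = 8 * y & oddz y.
Proof.
move=> /oddzP[i ->] /oddzP[j ->] e.
have e4 : (i + j + 1) * (i - j) = 2 ^+ 2 * (2 * k + 1) by lia.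
have ok : oddz (2 * k + 1) by rewrite /oddz; lia.
have [h|h] : oddz (i + j + 1) \/ oddz (i - j) by rewrite /oddz; lia.
- exists 1 => //.
  have [y ey oy] := oddz_dvd_exp2 h e4; exists y; first by lia.
  by rewrite -oy oddzM in ok; case/andP: ok.
- exists (-1) => //.
  rewrite mulrC in e4.
  have [y ey oy] := oddz_dvd_exp2 h e4; exists (- y); first by lia.
  by rewrite -oy oddzM in ok; case/andP: ok => _; rewrite /oddz; lia.
Qed.

(** * Linked coefficients *)

(* The fractions [q / p] equal to [7], [15] and [5/3] come from the triples
   [(al, be, ga)] equal to [(3, 7, 1)], [(1, 15, 1)] and [(1, 5, 3)]. *)
Definition linked (p q : int) : Prop := exists al be ga : int,
  [/\ oddz al, oddz be, oddz ga, al ^+ 2 + be * ga = 16 & p * be = q * ga].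

Lemma linked_sym p q : linked p q -> linked q p.
Proof.
move=> [al [be [ga [oa ob og e16 e]]]]; exists al, ga, be; split => //.
by rewrite (mulrC ga).
Qed.

Lemma linked_oddz p q : linked p q -> oddz p = oddz q.
Proof.
move=> [al [be [ga [oa ob og e16 e]]]].
by move/(congr1 oddz): e; rewrite !oddzM ob og !andbT.
Qed.

(** Modulo 8, [be * ga = 16 - al ^+ 2] is -1 and [ga ^+ 2] is 1, so multiplying [p * be = q * ga] by
    [ga] gives [- p = q]. *)
Lemma linked_mod8 p q : linked p q -> exists k : int, p + q = 8 * k.
Proof.
move=> [al [be [ga [oa ob og e16 e]]]].
have [i ei] := sqr_oddz oa; have [j ej] := sqr_oddz og.
have E : p * (16 - al ^+ 2) = q * ga ^+ 2.
  by rewrite -e16 expr2 mulrA -e; ring.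
by exists (2 * p - p * i - q * j); move: E; rewrite ei ej; lia.
Qed.

(* For [s = 1, -1] the matrix [1/2 [[al, s be], [s ga, -al]]] squares to [4] and
   multiplies [p x^2 + q y^2] by [4] when [p be = q ga]. On odd [(x, y)] exactly
   one of the two signs gives an odd second coordinate; [pair_sgn] picks it. *)
Definition pair_sgn (al ga : int) (v : int * int) : int :=
  if oddz ((ga * v.1 - al * v.2) %/ 2)%Z then 1 else -1.

Definition pair_quad (al be ga : int) (v : int * int) : int * int :=
  let s := pair_sgn al ga v in
  (((al * v.1 + s * be * v.2) %/ 2)%Z, ((s * ga * v.1 - al * v.2) %/ 2)%Z).

Lemma sqr_pair_sgn al ga v : pair_sgn al ga v ^+ 2 = 1.
Proof. by rewrite /pair_sgn; case: ifP. Qed.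

Lemma oddz_sgn (s : int) : s ^+ 2 = 1 -> oddz s.
Proof. by move=> /(congr1 oddz); rewrite expr2 oddzM andbb. Qed.

(** * The norm-4 map on odd pairs *)

Section PairQuad.
Context {al be ga : int}.
Context (oal : oddz al) (obe : oddz be) (oga : oddz ga).
Context (e16 : al ^+ 2 + be * ga = 16).

Lemma pair_quadE x y : oddz x -> oddz y ->
  let s := pair_sgn al ga (x, y) in let w := pair_quad al be ga (x, y) in
  [/\ 2 * w.1 = al * x + s * be * y, 2 * w.2 = s * ga * x - al * y,
      oddz w.1 & oddz w.2].
Proof.
move=> ox oy s w.
have ss : s ^+ 2 = 1 := sqr_pair_sgn _ _ _; have os := oddz_sgn ss.
have e1 : 2 * w.1 = al * x + s * be * y.
  by apply: half_evenz; rewrite oddzD !oddzM oal obe os ox oy.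
have e2 : 2 * w.2 = s * ga * x - al * y.
  by apply: half_evenz; rewrite oddzD oddzN !oddzM oal oga os ox oy.
(* The candidates for the two signs add up to the odd number [- al * y], so exactly one of them is
   odd. *)
have o2 : oddz w.2.
  have : s = if oddz ((ga * x - al * y) %/ 2)%Z then 1 else -1 by [].
  set h := (_ %/ 2)%Z; clearbody s; case: ifP => oh hs; rewrite hs in e2.
    by rewrite (_ : w.2 = h) // /h -[ga]mul1r -e2 mulKz.
  have eh : 2 * h = ga * x - al * y.
    by apply: half_evenz; rewrite oddzD oddzN !oddzM oal oga ox oy.
  have -> : w.2 = - h - al * y.
    apply: mul2zI; rewrite /= e2 mulrDr mulrN eh; ring.
  by rewrite oddzD !oddzN oh oddzM oal oy.
split=> //.
clearbody s w.
(* Second row of the relation that the matrix squares to 4; it transfers oddness from [w.2] to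
   [w.1]. *)
have e : s * (ga * w.1) = al * w.2 + 8 * y.
  apply: mul2zI => /=.
  rewrite (_ : 2 * _ = s * (ga * (2 * w.1))); last by ring.
  rewrite (_ : 2 * (_ + _) = al * (2 * w.2) + 16 * y); last by ring.
  by rewrite e1 e2; apply: (lincomb (be * ga * y) ss); apply: (lincomb (y) e16); ring.
have : oddz (s * (ga * w.1)) by rewrite e oddzD !oddzM oal o2.
by rewrite !oddzM oga => /andP[].
Qed.

(** Since the matrix squares to 4, applying it again with the same sign recovers the pair; the sign
    is that of the source pair. *)
Lemma pair_quadK x y : oddz x -> oddz y ->
  let s := pair_sgn al ga (x, y) in let w := pair_quad al be ga (x, y) in
  al * w.1 + s * be * w.2 = 8 * x /\ s * ga * w.1 - al * w.2 = 8 * y.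
Proof.
move=> ox oy s w.
have [e1 e2 _ _] := pair_quadE ox oy; rewrite -/s -/w in e1 e2.
have ss : s ^+ 2 = 1 := sqr_pair_sgn _ _ _; clearbody s w.
split; apply: mul2zI => /=.
- transitivity (al * (2 * w.1) + s * be * (2 * w.2)); first by ring.
  by rewrite e1 e2; apply: (lincomb (be * ga * x) ss); apply: (lincomb (x) e16); ring.
- transitivity (s * ga * (2 * w.1) - al * (2 * w.2)); first by ring.
  by rewrite e1 e2; apply: (lincomb (be * ga * y) ss); apply: (lincomb (y) e16); ring.
Qed.

Lemma pair_quad_form p q x y : p * be = q * ga -> oddz x -> oddz y ->
  let w := pair_quad al be ga (x, y) in
  p * w.1 ^+ 2 + q * w.2 ^+ 2 = 4 * (p * x ^+ 2 + q * y ^+ 2).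
Proof.
move=> epq ox oy w.
have [e1 e2 _ _] := pair_quadE ox oy; rewrite -/w in e1 e2.
set s := pair_sgn al ga (x, y) in e1 e2.
have ss : s ^+ 2 = 1 := sqr_pair_sgn _ _ _; clearbody s w.
apply/mul2zI/mul2zI => /=.
transitivity (p * (2 * w.1) ^+ 2 + q * (2 * w.2) ^+ 2); first by ring.
rewrite e1 e2; apply: (lincomb (p * be ^+ 2 * y ^+ 2 + q * ga ^+ 2 * x ^+ 2) ss).
apply: (lincomb (p * x ^+ 2 + q * y ^+ 2) e16).
by apply: (lincomb (2 * s * al * x * y - ga * x ^+ 2 + be * y ^+ 2) epq); ring.
Qed.

(** Equal signs are settled by [pair_quadK]. Opposite signs would make [8 * x - 8 * x'] twice the
    odd number [be * w.2], up to sign. *)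
Lemma pair_quad_inj x y x' y' : oddz x -> oddz y -> oddz x' -> oddz y' ->
  pair_quad al be ga (x, y) = pair_quad al be ga (x', y') -> (x, y) = (x', y').
Proof.
move=> ox oy ox' oy' E.
have [_ _ _ o2] := pair_quadE ox oy.
have [ex ey] := pair_quadK ox oy; have [ex' ey'] := pair_quadK ox' oy'.
rewrite -E in ex' ey'; move: (pair_quad al be ga (x, y)) o2 ex ey ex' ey' => w.
move=> o2; have ob2 : oddz (be * w.2) by rewrite oddzM obe.
have sgn v : pair_sgn al ga v = 1 \/ pair_sgn al ga v = -1.
  by rewrite /pair_sgn; case: ifP; [left|right].
have e8 (u v : int) : 8 * u = 8 * v -> u = v by lia.
have no (u v : int) : 8 * u - 8 * v = 2 * (be * w.2) -> False.
  by move: ob2 {sgn e8}; rewrite /oddz; move: (be * w.2) => A; clear; lia.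
case: (sgn (x, y)) (sgn (x', y')) => -> [] -> ex ey ex' ey'.
- by congr pair; apply: e8; rewrite -?ex -?ey.
- by case: (no x x'); rewrite -ex -ex'; ring.
- by case: (no x' x); rewrite -ex -ex'; ring.
- by congr pair; apply: e8; rewrite -?ex -?ey.
Qed.

Lemma pair_quad_surj p q u w k : p * be = q * ga -> oddz p ->
  oddz u -> oddz w -> p * u ^+ 2 + q * w ^+ 2 = 32 * k ->
  exists x y : int, [/\ oddz x, oddz y & pair_quad al be ga (x, y) = (u, w)].
Proof.
move=> epq op ou ow e.
have [j ej] := sqr_oddz ow.
(* The form [p u^2 + q w^2] is proportional to [ga u^2 + be w^2]; the odd factor [p] cancels modulo
   32. *)
have [k' ek'] : exists k' : int, ga * u ^+ 2 + be * w ^+ 2 = 32 * k'.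
  have E : p * (ga * u ^+ 2 + be * w ^+ 2) = 2 ^+ 5 * (ga * k).
    transitivity (ga * (p * u ^+ 2) + p * be * w ^+ 2); first by ring.
    rewrite epq; transitivity (ga * (p * u ^+ 2 + q * w ^+ 2)); first by ring.
    by rewrite e; ring.
  by have [c ec _] := oddz_dvd_exp2 op E; exists c.
(* The preimage must be a quarter of the matrix applied to [(u, w)]. Its second coordinate is an odd
   integer for a suitable sign because [(ga u)^2 - (al w)^2] is 16 modulo 32. *)
have [s ss [y ey oy]] : exists2 s : int, s ^+ 2 = 1
    & exists2 y : int, s * (ga * u) - al * w = 8 * y & oddz y.
  apply: (oddz_sqr_sub16 (k := ga * k' - 4 * j - 1)); rewrite ?oddzM ?oal ?oga //.
  transitivity (ga * (ga * u ^+ 2 + be * w ^+ 2) - 16 * w ^+ 2).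
    by apply: (lincomb (- w ^+ 2) e16); ring.
  by rewrite ek' ej; ring.
have os := oddz_sgn ss.
(* With the same sign the first coordinate is also an odd integer, by cancelling [ga]. *)
have EX : ga * (al * u + s * be * w) = 2 ^+ 3 * (s * (al * y + 2 * w)).
  transitivity (s * (al * (8 * y)) + 16 * s * w); last by ring.
  rewrite -ey; apply: (lincomb (- (ga * al * u)) ss).
  by apply: (lincomb (s * w) e16); ring.
have [x ex gx] := oddz_dvd_exp2 oga EX.
have ox : oddz x.
  have : oddz (ga * x) by rewrite gx oddzM oddzD !oddzM os oal oy.
  by rewrite oddzM => /andP[].
have e8 (m n : int) : 2 ^+ 3 * m = 8 * n -> m = n by lia.
have e1 : al * x + s * be * y = 2 * u.
  apply: e8; transitivity (al * (2 ^+ 3 * x) + s * be * (8 * y)); first by ring.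
  by rewrite -ex -ey; apply: (lincomb (be * ga * u) ss); apply: (lincomb (u) e16); ring.
have e2 : s * ga * x - al * y = 2 * w.
  apply: e8; transitivity (s * ga * (2 ^+ 3 * x) - al * (8 * y)); first by ring.
  by rewrite -ex -ey; apply: (lincomb (be * ga * w) ss); apply: (lincomb (w) e16); ring.
exists x, y; split => //.
(* The sign found is the one [pair_sgn] picks: it is the one for which the second coordinate is the
   odd [w]. *)
have es : pair_sgn al ga (x, y) = s.
  rewrite /pair_sgn /=.
  have [hs|hs] : s = 1 \/ s = -1.
    by move/eqP: ss; rewrite sqrf_eq1 => /orP[] /eqP; [left|right].
  - by rewrite hs mul1r in e2; rewrite e2 mulKz // ow.
  - have -> : ga * x - al * y = 2 * (- w - al * y).
      by rewrite mulrDr mulrN -e2 hs; ring.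
    by rewrite mulKz // oddzD !oddzN oddzM ow oal oy.
by rewrite /pair_quad /= es e1 e2 !mulKz.
Qed.

End PairQuad.

(** * Ternary representations sorted by parity *)

Definition tform (a b c : int) (v : int * int * int) : int :=
  a * v.1.1 ^+ 2 + b * v.1.2 ^+ 2 + c * v.2 ^+ 2.

Definition tsols (a b c m : int) (ox oy oz : bool) : set (int * int * int) :=
  [set v | [/\ tform a b c v = m, oddz v.1.1 = ox, oddz v.1.2 = oy & oddz v.2 = oz]].

Definition tsols_all (a b c m : int) : set (int * int * int) :=
  [set v | tform a b c v = m].

Definition row_of_triple (p : int * int * int) : 'rV[int]_3 :=
  \row_i nth 0 [:: p.1.1; p.1.2; p.2] i.

Lemma row_of_tripleK :
  cancel row_of_triple (fun v : 'rV[int]_3 => (v 0 0, v 0 1, v 0 2%:R)).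
Proof. by move=> [[x y] z]; rewrite !mxE. Qed.

Lemma row_of_triple_surj (v : 'rV[int]_3) :
  row_of_triple (v 0 0, v 0 1, v 0 2%:R) = v.
Proof.
apply/rowP => i; rewrite mxE; case: i => -[|[|[|//]]] h /=;
  by congr (v _ _); apply: val_inj.
Qed.

Lemma finite_tsols_all (a b c m : int) :
  0 < a -> 0 < b -> 0 < c -> finite_set (tsols_all a b c m).
Proof.
move=> ha hb hc; have fin := finite_diag3_sols m ha hb hc.
apply: sub_finite_set
  (finite_image (fun v : 'rV[int]_3 => (v 0 0, v 0 1, v 0 2%:R)) fin).
move=> v vm; exists (row_of_triple v); last exact: row_of_tripleK.
by rewrite -vm /diag3 /= !mxE.
Qed.

Lemma finite_tsols (a b c m : int) ox oy oz :
  0 < a -> 0 < b -> 0 < c -> finite_set (tsols a b c m ox oy oz).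
Proof.
move=> ha hb hc; apply: sub_finite_set (finite_tsols_all m ha hb hc).
by move=> v [].
Qed.

Lemma r_diag3E (a b c m : int) : 0 < a -> 0 < b -> 0 < c ->
  r (diag3 a b c) m = card_of (tsols_all a b c m).
Proof.
move=> ha hb hc; apply: (card_of_image (f := row_of_triple)).
- exact: finite_tsols_all.
- by move=> u v _ _; apply: (can_inj row_of_tripleK).
apply/seteqP; split=> [_ [v <- <-]|v vm]; first by rewrite /diag3 /= !mxE.
by exists (v 0 0, v 0 1, v 0 2%:R); [exact: vm|exact: row_of_triple_surj].
Qed.

Lemma t_tsols (a b c n : int) : 0 < a -> 0 < b -> 0 < c ->
  t a b c n = card_of (tsols a b c (8 * n + a + b + c) true true true).
Proof.
move=> ha hb hc; symmetry.
apply: (card_of_image (f := fun v => (2 * v.1.1 - 1, 2 * v.1.2 - 1, 2 * v.2 - 1))).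
- exact: finite_tri_sols.
- by move=> [[x y] z] [[x' y'] z'] _ _ [e1 e2 e3]; congr (_, _, _); lia.
have E x y z : tform a b c (2 * x - 1, 2 * y - 1, 2 * z - 1)
    = 8 * (a * tri x + b * tri y + c * tri z) + a + b + c.
  transitivity (4 * (a * (2 * tri x) + b * (2 * tri y) + c * (2 * tri z)) + a + b + c);
    last by ring.
  by rewrite !tri2 /tform /=; ring.
apply/seteqP; split=> [_ [[[x y] z] /= e <-]|[[x y] z] [e]].
  by split=> /=; rewrite ?E ?e // oddzD oddzN oddzM.
move=> /= /oddzP[i ei] /oddzP[j ej] /oddzP[k ek].
have ev : (x, y, z) = (2 * (i + 1) - 1, 2 * (j + 1) - 1, 2 * (k + 1) - 1).
  by congr (_, _, _); lia.
exists (i + 1, j + 1, k + 1) => //; rewrite /tri_sols /=.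
by move: e; rewrite ev E; lia.
Qed.

Lemma card_tsols_rot (a b c m : int) ox oy oz : 0 < a -> 0 < b -> 0 < c ->
  card_of (tsols b c a m oy oz ox) = card_of (tsols a b c m ox oy oz).
Proof.
move=> ha hb hc; apply: (card_of_image (f := fun v => (v.1.2, v.2, v.1.1))).
- exact: finite_tsols.
- by move=> [[x y] z] [[x' y'] z'] _ _ [-> -> ->].
have E x y z : tform b c a (y, z, x) = tform a b c (x, y, z).
  by rewrite /tform /=; ring.
apply/seteqP; split=> [_ [[[x y] z] [e /= ? ? ?] <-]|[[y z] x] [e /= ? ? ?]].
  by split => //; rewrite E.
by exists (x, y, z) => //; split=> //; rewrite -E.
Qed.

Lemma card_tsols_all_rot (a b c m : int) : 0 < a -> 0 < b -> 0 < c ->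
  card_of (tsols_all b c a m) = card_of (tsols_all a b c m).
Proof.
move=> ha hb hc; apply: (card_of_image (f := fun v => (v.1.2, v.2, v.1.1))).
- exact: finite_tsols_all.
- by move=> [[x y] z] [[x' y'] z'] _ _ [-> -> ->].
have E x y z : tform b c a (y, z, x) = tform a b c (x, y, z).
  by rewrite /tform /=; ring.
apply/seteqP; split=> [_ [[[x y] z] e <-]|[[y z] x] e].
  by rewrite /tsols_all /= E.
by exists (x, y, z) => //; rewrite /tsols_all /= -E.
Qed.

(** Halving all three coordinates. This class accounts for the term that the theorem subtracts. *)
Lemma card_tsols_even (a b c m : int) : 0 < a -> 0 < b -> 0 < c ->
  card_of (tsols a b c (4 * m) false false false) = card_of (tsols_all a b c m).
Proof.
move=> ha hb hc.
apply: (card_of_image (f := fun v => (2 * v.1.1, 2 * v.1.2, 2 * v.2))).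
- exact: finite_tsols_all.
- by move=> [[x y] z] [[x' y'] z'] _ _ [e1 e2 e3]; congr (_, _, _); lia.
have E x y z : tform a b c (2 * x, 2 * y, 2 * z) = 4 * tform a b c (x, y, z).
  by rewrite /tform /=; ring.
apply/seteqP; split=> [_ [[[x y] z] /= e <-]|[[x y] z] [e /=]].
  by split=> /=; rewrite ?E ?e ?oddzM.
move=> /negbT/sqr_evenz[i ei _] /negbT/sqr_evenz[j ej _] /negbT/sqr_evenz[k ek _].
exists (i, j, k); last by rewrite ei ej ek.
by apply: (@mulfI _ (4 : int)) => //; rewrite -E -ei -ej -ek.
Qed.

(* The bijection is [pair_quad] on the first two coordinates and doubling on
   the third. *)
Lemma card_tsols_linked (a b c n : int) : 0 < a -> 0 < b -> 0 < c ->
  linked a b -> oddz a -> oddz c ->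
  card_of (tsols a b c (4 * (8 * n + a + b + c)) true true false)
  = card_of (tsols a b c (8 * n + a + b + c) true true true).
Proof.
move=> ha hb hc lab oa oc.
have [k8 e8] := linked_mod8 lab; have ob := linked_oddz lab; rewrite oa in ob.
case: lab => al [be [ga [oal obe oga e16 epq]]].
pose f (v : int * int * int) := (pair_quad al be ga v.1, 2 * v.2).
apply: (card_of_image (f := f)).
- exact: finite_tsols.
- move=> [[x y] z] [[x' y'] z']; rewrite !inE.
  move=> [_ /= ox oy _] [_ /= ox' oy' _] [e1 e2 ez].
  have -> : z = z' := mul2zI ez.
  congr (_, _); apply: (pair_quad_inj oal obe oga e16) => //.
  by rewrite /pair_quad /= e1 e2.
apply/seteqP; split=> [_ [[[x y] z] [e /= ox oy oz] <-]|[[u w] z2] [e /= ou ow oz]].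
  have [_ _ o1 o2] := pair_quadE oal obe oga e16 ox oy.
  split=> //=; last by rewrite oddzM.
  rewrite /tform /= (pair_quad_form oal obe oga e16 epq ox oy) -e /tform /=.
  by ring.
have [z ez ez2] := sqr_evenz (negbT oz).
have [i ei] := sqr_oddz ou; have [j ej] := sqr_oddz ow.
have {}e : a * u ^+ 2 + b * w ^+ 2 = 4 * (8 * n + a + b + c - c * z ^+ 2).
  by rewrite mulrBr -e /tform /= ez2; ring.
(* Since 8 divides [a + b], the left side of [e] is 0 modulo 8, so [a + b + c - c * z ^+ 2] is even;
   as [a + b] is even and [c] odd, [c * z ^+ 2] is odd. *)
have ozz : oddz z.
  have : oddz (c * z ^+ 2).
    move: e oa oc; rewrite ei ej /oddz.
    have -> : a * (8 * i + 1) + b * (8 * j + 1) = 8 * (a * i + b * j) + (a + b) by ring.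
    by move: (a * i + b * j) (c * z ^+ 2) => A B; lia.
  by rewrite oddzM expr2 oddzM; case/and3P.
have [k ek] := sqr_oddz ozz.
have [x [y [ox oy exy]]] : exists x y : int,
    [/\ oddz x, oddz y & pair_quad al be ga (x, y) = (u, w)].
  apply: (pair_quad_surj (k := n + k8 - c * k) oal obe oga e16 epq) => //.
  by rewrite e ek; apply: (lincomb 4 e8); ring.
exists (x, y, z); last by rewrite /f /= exy ez.
split=> //.
have := pair_quad_form oal obe oga e16 epq ox oy; rewrite exy /= e.
by move=> /(@mulfI _ (4 : int) isT); rewrite /tform /= => <-; ring.
Qed.

(** * The identity when the middle coefficient is linked to both others *)

Lemma tsols_all_split (a b c n : int) : linked a b -> linked b c -> oddz b ->
  tsols_all a b c (4 * (8 * n + a + b + c)) =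
  tsols a b c (4 * (8 * n + a + b + c)) false false false
  `|` (tsols a b c (4 * (8 * n + a + b + c)) true true false
  `|` tsols a b c (4 * (8 * n + a + b + c)) false true true).
Proof.
move=> lab lbc ob.
have [k ek] := linked_mod8 lab; have [l el] := linked_mod8 lbc.
apply/seteqP; split=> [[[x y] z]|v [[]//|[[]//|[]//]]]; rewrite /tsols_all /= => e.
have {}e : a * x ^+ 2 + b * y ^+ 2 + c * z ^+ 2 = 4 * (8 * n + a + b + c) := e.
have oa := linked_oddz lab; have oc := linked_oddz lbc.
have : oddz x (+) oddz y (+) oddz z = false.
  by move/(congr1 oddz): e; rewrite !oddzD !expr2 !oddzM -oc oa ob !andbb.
case ox: (oddz x); case oy: (oddz y); case oz: (oddz z) => // _.
- by right; left.
(* The pattern odd, even, odd is impossible: modulo 4 the form is [a + c], which is [-2 b], hence 2,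
   whereas the value is a multiple of 4. *)
- have [i ei] := sqr_oddz ox; have [j ej] := sqr_oddz oz.
  have [y' _ ey'] := sqr_evenz (negbT oy).
  have [b' eb] := oddzP _ ob.
  exfalso; have eab : a = 8 * k - b by lia.
  have ec : c = 8 * l - b by lia.
  suff : 2 = 4 * (a * i * 2 + c * j * 2 + b * y' ^+ 2 + 2 * k + 2 * l - b'
                  - (8 * n + a + b + c)) by lia.
  by move: e; rewrite ei ej ey'; clear -eab ec eb; lia.
- by right; right.
- by left.
Qed.

Lemma card_tsols_all_pivot (a b c n : int) : 0 < a -> 0 < b -> 0 < c ->
  linked a b -> linked b c -> oddz b ->
  card_of (tsols_all a b c (4 * (8 * n + a + b + c))) =
  (card_of (tsols_all a b c (8 * n + a + b + c))
   + 2 * card_of (tsols a b c (8 * n + a + b + c) true true true))%N.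
Proof.
move=> ha hb hc lab lbc ob.
have oa : oddz a by rewrite (linked_oddz lab).
have oc : oddz c by rewrite -(linked_oddz lbc).
have fin := finite_tsols.
rewrite (tsols_all_split n lab lbc ob) card_of_disjointU; last first.
- by apply/seteqP; split=> // v [[_ _ h _] [[_ _ h' _]|[_ _ h' _]]]; rewrite h in h'.
- by rewrite finite_setU; split; apply: fin.
- exact: fin.
rewrite card_of_disjointU; [|exact: fin|exact: fin|]; last first.
  by apply/seteqP; split=> // v [[_ h _ _] [_ h' _ _]]; rewrite h in h'.
rewrite card_tsols_even // card_tsols_linked //.
(* Rotating the coefficients puts the odd pair [(y, z)] first, so that the bijection for
   [linked b c] applies. *)
have e : 8 * n + a + b + c = 8 * n + b + c + a by ring.
rewrite -(card_tsols_rot _ false true true) // e card_tsols_linked //.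
by rewrite (@card_tsols_rot a b c _ true true true) // addnn mul2n.
Qed.

Lemma twice_t_pivot (a b c n : int) : 0 < a -> 0 < b -> 0 < c ->
  linked a b -> linked b c -> gcdz (gcdz a b) c = 1 ->
  2 * (t a b c n)%:Z = (r (diag3 a b c) (4 * (8 * n + a + b + c)))%:Z
    - (r (diag3 a b c) (8 * n + a + b + c))%:Z.
Proof.
move=> ha hb hc lab lbc hgcd.
(* Linked coefficients have equal parity, so an even [b] would make 2 divide the gcd. *)
have ob : oddz b.
  apply/negPn/negP => eb.
  have ea : ~~ oddz a by rewrite (linked_oddz lab).
  have ec : ~~ oddz c by rewrite -(linked_oddz lbc).
  have d2 x : ~~ oddz x -> (2 %| x)%Z.
    by case/sqr_evenz => k -> _; rewrite dvdz_mulr.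
  have : (2 %| gcdz (gcdz a b) c)%Z by rewrite !dvdz_gcd !d2.
  by rewrite hgcd.
rewrite !r_diag3E // t_tsols // card_tsols_all_pivot //.
by rewrite PoszD PoszM [RHS]addrC addKr.
Qed.

(** Both sides are invariant under cyclic rotation, so the coefficient linked to both others may be
    assumed to be in the middle. *)
Lemma twice_t_rot (a b c n : int) : 0 < a -> 0 < b -> 0 < c ->
  2 * (t b c a n)%:Z = (r (diag3 b c a) (4 * (8 * n + b + c + a)))%:Z
    - (r (diag3 b c a) (8 * n + b + c + a))%:Z ->
  2 * (t a b c n)%:Z = (r (diag3 a b c) (4 * (8 * n + a + b + c)))%:Z
    - (r (diag3 a b c) (8 * n + a + b + c))%:Z.
Proof.
move=> ha hb hc; have -> : 8 * n + a + b + c = 8 * n + b + c + a by ring.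
rewrite !r_diag3E // !(@card_tsols_all_rot a b c) // => <-.
rewrite !t_tsols // (@card_tsols_rot a b c) //.
by have -> : 8 * n + a + b + c = 8 * n + b + c + a by ring.
Qed.

(** * From the fractions to linked coefficients *)

Lemma frac_set_linked (p q : int) : 0 < p -> 0 < q ->
  q%:Q / p%:Q \in frac_set -> p = q \/ linked p q.
Proof.
move=> hp hq; have p0 : p%:Q != 0 by rewrite intr_eq0 gt_eqF.
have frac (u v : int) : v != 0 -> q%:Q / p%:Q = u%:Q / v%:Q -> p * u = q * v.
  move=> v0 /eqP; rewrite eqr_div ?(intr_eq0 _ v) // -!intrM eqr_int => /eqP ->.
  by rewrite mulrC.
rewrite !inE => /or4P[] /eqP e; [left|right..].
- by have := frac 1 1 isT; rewrite e divr1 !mulr1 => ->.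
- by exists 1, 5, 3; split=> //; apply: frac.
- by exists 3, 7, 1; split=> //; apply: frac => //; rewrite e divr1.
- by exists 1, 15, 1; split=> //; apply: frac => //; rewrite e divr1.
Qed.

Theorem theorem3p3 (a b c : int) (ha : 0 < a) (hb : 0 < b) (hc : 0 < c)
    (hne : (a, b, c) <> (1, 1, 1))
    (hgcd : gcdz (gcdz a b) c = 1)
    (hfrac : (2 <= count (mem frac_set)
                     [:: b%:Q / a%:Q; c%:Q / b%:Q; c%:Q / a%:Q])%N)
    (n : int) (hn : 0 < n) :
  2 * (t a b c n)%:Z =
    (r (diag3 a b c) (4 * (8 * n + a + b + c)))%:Z
    - (r (diag3 a b c) (8 * n + a + b + c))%:Z.
Proof.
have gb : gcdz (gcdz b c) a = 1 by rewrite gcdzC gcdzA.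
have gc : gcdz (gcdz c a) b = 1 by rewrite -gcdzA gcdzC.
have pivb : linked a b -> linked b c -> _ :=
  fun l l' => twice_t_pivot n ha hb hc l l' hgcd.
have pivc (l : linked b c) (l' : linked c a) :=
  twice_t_rot ha hb hc (twice_t_pivot n hb hc ha l l' gb).
have piva (l : linked c a) (l' : linked a b) := twice_t_rot ha hb hc
  (twice_t_rot hb hc ha (twice_t_pivot n hc ha hb l l' gc)).
(* Three equal coefficients with gcd 1 are all 1, the excluded triple. *)
have no : a = b -> b = c -> False.
  move=> ab bc; apply: hne; move: hgcd; rewrite ab bc gcdzz.
  by rewrite /gcdz absz_nat gcdnn => -[e]; congr (_, _, _); lia.
have [] : [\/ linked a b /\ linked b c, linked b c /\ linked c a
    | linked c a /\ linked a b]; last 3 first.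
- by case.
- by case.
- by case.
(* Two of the pairs are equal or linked. Two links share a coefficient; one equality carries the
   remaining link over to another pair; two equalities contradict [no]. *)
have [ba|ba] := boolP (b%:Q / a%:Q \in frac_set);
have [cb|cb] := boolP (c%:Q / b%:Q \in frac_set).
- have [ab|lab] := frac_set_linked ha hb ba; have [bc|lbc] := frac_set_linked hb hc cb.
  + by case: no.
  + by apply: Or32; rewrite ab; split=> //; apply: linked_sym.
  + by apply: Or33; split=> //; apply: linked_sym; rewrite -bc.
  + by apply: Or31.
- have ca : c%:Q / a%:Q \in frac_set.
    by move: hfrac; rewrite /= ba (negbTE cb); case: (_ \in _).
  have [ab|lab] := frac_set_linked ha hb ba; have [ac|lac] := frac_set_linked ha hc ca.
  + by case: no => //; rewrite -ab.
  + by apply: Or32; split; [rewrite -ab|apply: linked_sym].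
  + by apply: Or31; split=> //; apply: linked_sym; rewrite -ac.
  + by apply: Or33; split=> //; apply: linked_sym.
- have ca : c%:Q / a%:Q \in frac_set.
    by move: hfrac; rewrite /= cb (negbTE ba); case: (_ \in _).
  have [bc|lbc] := frac_set_linked hb hc cb; have [ac|lac] := frac_set_linked ha hc ca.
  + by case: no => //; rewrite bc.
  + by apply: Or33; split; [apply: linked_sym|rewrite bc].
  + by apply: Or31; split=> //; apply: linked_sym; rewrite ac.
  + by apply: Or32; split=> //; apply: linked_sym.
- by move: hfrac; rewrite /= (negbTE ba) (negbTE cb); case: (_ \in _).
Qed.
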